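(* Let $D_L\in\mathbb{R}_{\ge0}^{l\times l}$ be symmetric with zero diagonal, $D_N\in\mathbb{R}_{\ge0}^{m\times l}$, $d\ge1$ an integer and $\kappa>0$. Suppose $A_L=\cosh(\sqrt{\kappa}D_L)$ has at least $d$ strictly negative eigenvalues. Then the matrices $\hat X_L,\hat X_N$ returned by L-hydra$(D_L,D_N,d,\kappa)$ satisfy: (i) $\hat X_L$ minimizes $\|A_L - X_L J X_L^\top\|_F$ over all $X_L\in\mathbb{R}^{l\times(d+1)}$; (ii) $\hat X_N$ minimizes $\|A_N - X_N J \hat X_L^\top\|_F$ over all $X_N\in\mathbb{R}^{m\times(d+1)}$; (iii) every entry of the first column of $\hat X_L$ and of the first column of $\hat X_N$ is strictly positive, i.e., all rows of $\hat X_L$ and $\hat X_N$ lie in the positive Lorentz space $\{\bm{x}\in\mathbb{R}^{d+1}: x_1>0\}$.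
   Context: $\|\cdot\|_F$ is the Frobenius norm. $J=\operatorname{diag}(1,-1,\dots,-1)\in\mathbb{R}^{(d+1)\times(d+1)}$. Algorithm L-hydra$(D_L,D_N,d,\kappa)$: input a symmetric $D_L\in\mathbb{R}_{\ge0}^{l\times l}$ with zero diagonal, $D_N\in\mathbb{R}_{\ge 0}^{m\times l}$, an integer $d\ge1$ and $\kappa>0$. Step 1: set $A_L=\cosh(\sqrt{\kappa}D_L)$, $A_N=\cosh(\sqrt{\kappa}D_N)$ (cosh applied entrywise) and take an eigendecomposition $A_L=Q\Lambda Q^\top$ with $Q$ orthogonal, columns $\bm{q}_1,\dots,\bm{q}_l$, and $\Lambda=\operatorname{diag}(\lambda_1,\dots,\lambda_l)$, $\lambda_1\ge\dots\ge\lambda_l$; the sign of $\bm{q}_1$ is chosen so that its entries are positive (Perron vector). Step 2: if $\lambda_{l-d+1},\dots,\lambda_l$ are not all strictly negative (or $l<d+1$), return Null; otherwise set $\hat X_L=\big[\sqrt{\lambda_1}\bm{q}_1,\ \sqrt{-\lambda_{l-d+1}}\bm{q}_{l-d+1},\ \dots,\ \sqrt{-\lambda_l}\bm{q}_l\big]\in\mathbb{R}^{l\times(d+1)}$. Step 3: set $\hat X_N=A_N\big[\bm{q}_1/\sqrt{\lambda_1},\ -\bm{q}_{l-d+1}/\sqrt{-\lambda_{l-d+1}},\ \dots,\ -\bm{q}_l/\sqrt{-\lambda_l}\big]\in\mathbb{R}^{m\times(d+1)}$. Return $\hat X=\begin{psmallmatrix}\hat X_L\\ \hat X_N\end{psmallmatrix}$.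 *)

(* Defs.v *)
From mathcomp Require Import all_boot all_order all_algebra.
From mathcomp Require Import reals.
From mathcomp Require Import sequences.
Set Implicit Arguments. Unset Strict Implicit. Unset Printing Implicit Defensive.
Import Order.TTheory GRing.Theory Num.Theory.
Local Open Scope ring_scope.

Section LHydra.
Variable R : realType.

Definition coshR (x : R) : R := (expR x + expR (- x)) / 2.

Definition cosh_mx m n (kappa : R) (D : 'M[R]_(m, n)) : 'M[R]_(m, n) :=
  \matrix_(i, j) coshR (Num.sqrt kappa * D i j).

Definition frob m n (A : 'M[R]_(m, n)) : R :=
  Num.sqrt (\sum_i \sum_j (A i j) ^+ 2).

Definition Jmx d : 'M[R]_d.+1 :=
  \matrix_(i, j) (if i == j then (if i == ord0 then 1 else -1) else 0).

Definition colnat m n (Q : 'M[R]_(m, n)) (k : nat) (i : 'I_m) : R :=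
  if insub k is Some j then Q i j else 0.
Definition lamnat n (lam : 'I_n -> R) (k : nat) : R :=
  if insub k is Some j then lam j else 0.

(* (0-based) index of the eigenpair used for column j of X_L:
   column 0 uses eigenpair 0 (largest eigenvalue), column j >= 1 uses
   eigenpair l-d-1+j, i.e. the d smallest eigenvalues in increasing index. *)
Definition eidx l d (j : 'I_d.+1) : nat :=
  if val j == 0%N then 0%N else (l - d.+1 + j)%N.

Definition sorted_eigendecomp l (A Q : 'M[R]_l) (lam : 'I_l -> R) : Prop :=
  Q^T *m Q = 1%:M /\
  A = Q *m diag_mx (\row_i lam i) *m Q^T /\
  (forall i j : 'I_l, (i <= j)%N -> lam j <= lam i).

(* Algorithm L-hydra, Steps 2-3, given the eigendecomposition (Q, lam) of
   A_L chosen in Step 1. Returns None for Null. *)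
Definition lhydra l m (Q : 'M[R]_l) (lam : 'I_l -> R) (DN : 'M[R]_(m, l))
    (d : nat) (kappa : R) : option ('M[R]_(l, d.+1) * 'M[R]_(m, d.+1)) :=
  if (d.+1 <= l)%N && [forall k : 'I_l, (l - d <= k)%N ==> (lam k < 0)] then
    let XL := \matrix_(i < l, j < d.+1)
        (Num.sqrt (if val j == 0%N then lamnat lam (eidx l j)
                   else - lamnat lam (eidx l j)) * colnat Q (eidx l j) i) in
    let W := \matrix_(i < l, j < d.+1)
        (if val j == 0%N then colnat Q (eidx l j) i / Num.sqrt (lamnat lam (eidx l j))
         else - colnat Q (eidx l j) i / Num.sqrt (- lamnat lam (eidx l j))) in
    Some (XL, cosh_mx kappa DN *m W)
  else None.

End LHydra.

(* Main.v *)
(* In the eigenbasis of A_L claim (i) asks for a lower bound on the norm of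
   C = Lambda - x x^T + Y Y^T, with x one column and Y having d columns, by the
   norm of the eigenvalues that L-hydra discards.  It is obtained by duality:
   since |C - Z|^2 >= 0, any Z with <C, Z> >= |Z|^2 gives |C|^2 >= |Z|^2.  Take
   Z = P M P - P' M' P', where M is the positive part of Lambda, M' its negative
   part truncated at b = -lambda_{l-d+1}, and P, P' are the projections
   orthogonal to x and Y compressed to the supports of M and M'.  Then
   <x x^T, P M P> = <Y Y^T, P' M' P'> = 0 and the remaining cross terms have the
   right sign, while removing a k-dimensional space from 0 <= M <= t lowers
   |M|^2 by at most k t^2.  Claim (ii) is the normal equation of a linear least
   squares problem. *)
Require Import Defs.
From mathcomp Require Import all_boot all_order all_algebra.
From mathcomp Require Import reals.
From mathcomp Require Import sequences exp.
From mathcomp Require Import zify ring lra.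
Set Implicit Arguments.
Unset Strict Implicit.
Unset Printing Implicit Defensive.

Import Order.TTheory GRing.Theory Num.Theory.
Local Open Scope ring_scope.

(** * The Frobenius inner product as a trace *)

Lemma mxtrace_mul_tr (R : comPzRingType) m n (A B : 'M[R]_(m, n)) :
  \tr (A *m B^T) = \sum_i \sum_j A i j * B i j.
Proof.
by apply: eq_bigr => i _; rewrite mxE; apply: eq_bigr => j _; rewrite mxE.
Qed.

Lemma mxtrace_sqr_ge0 (R : realDomainType) m n (A : 'M[R]_(m, n)) :
  0 <= \tr (A *m A^T).
Proof.
by rewrite mxtrace_mul_tr; do 2![apply: sumr_ge0 => ? _]; rewrite -expr2 sqr_ge0.
Qed.

Lemma mxtrace_sqr_eq0 (R : realDomainType) m n (A : 'M[R]_(m, n)) :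
  \tr (A *m A^T) = 0 -> A = 0.
Proof.
rewrite mxtrace_mul_tr => /eqP; rewrite psumr_eq0; last first.
  by move=> i _; apply: sumr_ge0 => j _; rewrite -expr2 sqr_ge0.
move/allP => A0; apply/matrixP => i j; rewrite mxE.
have /= := A0 i (mem_index_enum i); rewrite psumr_eq0; last first.
  by move=> k _; rewrite -expr2 sqr_ge0.
by move/allP/(_ j (mem_index_enum j)); rewrite /= mulf_eq0 orbb => /eqP.
Qed.

Lemma frob_sqr_tr (R : realType) m n (A : 'M[R]_(m, n)) :
  frob A = Num.sqrt (\tr (A *m A^T)).
Proof.
by rewrite mxtrace_mul_tr; congr Num.sqrt; do 2![apply: eq_bigr => ? _].
Qed.

Lemma frob_le (R : realType) m n p q (A : 'M[R]_(m, n)) (B : 'M[R]_(p, q)) :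
  \tr (A *m A^T) <= \tr (B *m B^T) -> frob A <= frob B.
Proof. by rewrite !frob_sqr_tr; exact: ler_wsqrtr. Qed.

Lemma mxtrace_diag_conj_ge0 (R : realDomainType) n p (u : 'rV[R]_n)
    (X : 'M[R]_(n, p)) :
  (forall i, 0 <= u 0 i) -> 0 <= \tr (X^T *m diag_mx u *m X).
Proof.
move=> u0; rewrite -mulmxA mxtrace_mulC mxtrace_mul_tr mul_diag_mx.
apply: sumr_ge0 => i _; apply: sumr_ge0 => j _.
by rewrite mxE -mulrA -expr2 mulr_ge0 ?sqr_ge0.
Qed.

(** * Projections and deflation of nonnegative diagonal matrices *)

(** Replacing the columns of [Y] by a basis [V] of their span makes the Gram matrix invertible even
    when [Y] is rank deficient; the trace of the projection is then the rank of [Y]. *)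
Lemma orthogonal_projection (R : realFieldType) n k (Y : 'M[R]_(n, k)) :
  exists E : 'M[R]_n,
    [/\ E^T = E, E *m E = E, E *m Y = Y, \tr E <= k%:R
      & exists W, E = Y *m W].
Proof.
set V := row_base Y^T.
have [W1 YV] : exists W1, Y^T = W1 *m V.
  by apply/submxP; rewrite eq_row_base.
have [W2 VY] : exists W2, V = W2 *m Y^T.
  by apply/submxP; rewrite eq_row_base.
have Vfree : row_free V by exact: row_base_free.
clearbody V.
set Gr := V *m V^T.
(* A row [x] with [x Gr = 0] has [|x V|^2 = x Gr x^T = 0], and [V] has independent rows. *)
have GrU : Gr \in unitmx.
  rewrite -row_free_unit -kermx_eq0; apply/eqP/(row_free_inj Vfree).
  rewrite /= mul0mx; apply: mxtrace_sqr_eq0.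
  by rewrite trmx_mul !mulmxA -(mulmxA _ V) mulmx_ker mul0mx linear0.
have GrT : Gr^T = Gr by rewrite trmx_mul trmxK.
exists (V^T *m invmx Gr *m V); split.
- by rewrite !trmx_mul trmxK trmx_inv GrT mulmxA.
- rewrite !mulmxA -(mulmxA _ V V^T) -/Gr -(mulmxA _ (invmx Gr) Gr).
  by rewrite mulVmx // mulmx1.
- have YE : Y = V^T *m W1^T by apply: trmx_inj; rewrite trmx_mul !trmxK.
  rewrite [X in _ *m X]YE !mulmxA -(mulmxA _ V V^T) -/Gr.
  by rewrite -(mulmxA _ (invmx Gr) Gr) mulVmx // mulmx1.
- rewrite mxtrace_mulC mulmxA mulmxV // mxtrace1 ler_nat.
  by rewrite mxrank_tr rank_leq_col.
- by exists (W2^T *m invmx Gr *m V); rewrite {1}VY trmx_mul trmxK !mulmxA.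
Qed.

Lemma deflated_diag (R : realFieldType) n k (mu : 'I_n -> R) (t : R)
    (Y : 'M[R]_(n, k)) :
  (forall i, 0 <= mu i <= t) ->
  exists Z : 'M[R]_n,
    [/\ forall p (X : 'M[R]_(n, p)), 0 <= \tr (X^T *m Z *m X),
        Z *m Y = 0,
        forall i j, mu i = 0 -> Z i j = 0,
        \tr (diag_mx (\row_i mu i) *m Z) = \tr (Z *m Z^T)
      & \sum_i mu i ^+ 2 - k%:R * t ^+ 2 <= \tr (Z *m Z^T)].
Proof.
move=> mu_t.
set M := diag_mx (\row_i mu i).
set G : 'M[R]_n := diag_mx (\row_i (mu i != 0)%:R).
have MT : M^T = M by rewrite tr_diag_mx.
have GT : G^T = G by rewrite tr_diag_mx.
have GM : G *m M = M.
  apply/matrixP => i j; rewrite mul_diag_mx !mxE.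
  by case: (eqVneq (mu i) 0) => [->|_]; rewrite ?mul1r // mul0rn mulr0.
have MG : M *m G = M by rewrite -[LHS]trmxK trmx_mul GT MT GM MT.
(* Projecting onto the range of [G Y] instead of that of [Y] makes [E] commute with [G]. Hence
   [P M P] stays on the support of [mu], and it still kills [Y] because [M = M G]. *)
have [E [ET EE EY trE [W EW]]] := orthogonal_projection (G *m Y).
have GG : G *m G = G.
  apply/matrixP => i j; rewrite mul_diag_mx !mxE.
  by case: (eqVneq (mu i) 0) => [|_]; rewrite ?mul1r // mul0rn mulr0.
have GE : G *m E = E by rewrite EW !mulmxA GG.
have EG : E *m G = E by rewrite -[LHS]trmxK trmx_mul GT ET GE ET.
set P := 1%:M - E.
have PT : P^T = P by rewrite linearB /= trmx1 ET.
have PP : P *m P = P.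
  by rewrite mulmxBl mul1mx mulmxBr mulmx1 EE subrr subr0.
have GP : G *m P = P *m G.
  by rewrite mulmxBl mulmxBr mul1mx mulmx1 EG GE.
have PGY : P *m (G *m Y) = 0 by rewrite mulmxBl mul1mx EY subrr.
exists (P *m M *m P).
have ZT : (P *m M *m P)^T = P *m M *m P.
  by rewrite !trmx_mul PT MT mulmxA.
have MZ : \tr (M *m (P *m M *m P)) = \tr (P *m M *m P *m (P *m M *m P)^T).
  rewrite ZT !mulmxA -(mulmxA _ P P) PP.
  by rewrite [RHS]mxtrace_mulC !mulmxA PP mxtrace_mulC !mulmxA.
split => //.
- move=> p X.
  have -> : X^T *m (P *m M *m P) *m X = (P *m X)^T *m M *m (P *m X).
    by rewrite trmx_mul PT !mulmxA.
  apply: mxtrace_diag_conj_ge0 => i; rewrite mxE.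
  by have /andP[] := mu_t i.
- by rewrite -MG -!mulmxA (mulmxA G) GP -(mulmxA P G) PGY !mulmx0.
- move=> i j mui0.
  have -> : P *m M *m P = G *m (P *m M *m P).
    by rewrite !mulmxA GP -(mulmxA P G) GM.
  by rewrite mul_diag_mx !mxE mui0 eqxx mul0r.
rewrite -MZ.
have trM : \tr (M *m M) = \sum_i mu i ^+ 2.
  by apply: eq_bigr => i _; rewrite mul_diag_mx !mxE eqxx.
(* Both [t E - E M E] and [M (t - M)] compressed to E are used: together they
   give [2 tr (E M^2) - tr (E M E M) <= t^2 tr E]. *)
have F0 := mxtrace_sqr_ge0 (t *: E - E *m M *m E).
have E0 : 0 <= \tr (E^T *m diag_mx (\row_i (t * mu i - mu i ^+ 2)) *m E).
  apply: mxtrace_diag_conj_ge0 => i; rewrite mxE.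
  by have /andP[m0 mt] := mu_t i; nra.
have dE : diag_mx (\row_i (t * mu i - mu i ^+ 2)) = t *: M - M *m M.
  apply/matrixP => i j; rewrite mul_diag_mx !mxE.
  by case: eqP => [->|_]; rewrite ?mulr1n ?mulr0n ?mulr0 ?subrr.
rewrite dE ET mxtrace_mulC mulmxA EE mulmxBr linearB /= in E0.
rewrite -scalemxAr linearZ /= in E0.
have trEME : \tr (E *m M *m E) = \tr (E *m M) by rewrite mxtrace_mulC mulmxA EE.
have trEMEME : \tr (E *m M *m E *m M *m E) = \tr (E *m M *m E *m M).
  by rewrite mxtrace_mulC !mulmxA EE.
have {}F0 : 0 <= t ^+ 2 * \tr E - 2 * t * \tr (E *m M) + \tr (E *m M *m E *m M).
  move: F0; rewrite linearB /= linearZ /= !trmx_mul ET MT !mulmxBl !mulmxBr.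
  rewrite -!scalemxAl -!scalemxAr !linearB /= !linearZ /= !mulmxA EE.
  rewrite -(mulmxA _ E E) EE trEME trEMEME; congr (_ <= _); ring.
have -> : \tr (M *m (P *m M *m P)) =
    \tr (M *m M) - 2 * \tr (E *m (M *m M)) + \tr (E *m M *m E *m M).
  rewrite /P !mulmxBl !mul1mx !mulmxBr !mulmx1 !linearB /= !mulmxA.
  have -> : \tr (M *m M *m E) = \tr (E *m M *m M) by rewrite mxtrace_mulC mulmxA.
  have -> : \tr (M *m E *m M) = \tr (E *m M *m M) by rewrite -mulmxA mxtrace_mulC.
  have -> : \tr (M *m E *m M *m E) = \tr (E *m M *m E *m M).
    by rewrite mxtrace_mulC !mulmxA.
  ring.
rewrite trM.
have : 0 <= t ^+ 2 * (k%:R - \tr E) by rewrite mulr_ge0 ?sqr_ge0 // subr_ge0.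
by move: E0 F0; rewrite mulmxA; nra.
Qed.

(** * The dual lower bound *)

Lemma signature_approx_bound (R : realFieldType) n p q (lam u v : 'I_n -> R)
    (a b : R) (X : 'M[R]_(n, p)) (Y : 'M[R]_(n, q)) (C : 'M[R]_n) :
  C = diag_mx (\row_i lam i) - (X *m X^T - Y *m Y^T) ->
  (forall i, 0 <= u i <= a) -> (forall i, 0 <= v i <= b) ->
  (forall i, u i != 0 -> u i <= lam i) ->
  (forall i, v i != 0 -> v i <= - lam i) ->
  \sum_i u i ^+ 2 + \sum_i v i ^+ 2 - p%:R * a ^+ 2 - q%:R * b ^+ 2
    <= \tr (C *m C^T).
Proof.
move=> CE ua vb ul vl.
have CT : C^T = C by rewrite CE !linearB /= tr_diag_mx !trmx_mul !trmxK.
(* A positive semidefinite [Z] has nonnegative diagonal entries, and those outside the support of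
   [w] vanish, so only the comparison on the support matters. *)
have diag_le (w mu : 'I_n -> R) (Z : 'M[R]_n) :
    (forall k (T : 'M[R]_(n, k)), 0 <= \tr (T^T *m Z *m T)) ->
    (forall i j, w i = 0 -> Z i j = 0) ->
    (forall i, w i != 0 -> w i <= mu i) ->
    \tr (diag_mx (\row_i w i) *m Z) <= \tr (diag_mx (\row_i mu i) *m Z).
  move=> Zpos Zsupp wmu; apply: ler_sum => i _; rewrite !mul_diag_mx !mxE.
  have [/Zsupp->|/wmu wi] := eqVneq (w i) 0; first by rewrite !mulr0.
  apply: ler_wpM2r => //; have := Zpos _ (delta_mx i 0 : 'cV_n).
  by rewrite trmx_delta -rowE -colE /mxtrace big_ord1 !mxE.
have [U [Upos UX Usupp Utr Ubound]] := deflated_diag X ua.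
have [V [Vpos VY Vsupp Vtr Vbound]] := deflated_diag Y vb.
(* The supports are disjoint: [u i > 0] forces [lam i > 0], while [v i > 0] forces [lam i < 0]. *)
have UV : \tr (U *m V^T) = 0.
  rewrite mxtrace_mul_tr big1 // => i _; rewrite big1 // => j _.
  have [/Usupp->|ui] := eqVneq (u i) 0; first by rewrite mul0r.
  have [/Vsupp->|vi] := eqVneq (v i) 0; first by rewrite mulr0.
  have := ul _ ui; have := vl _ vi; have /andP[u0 _] := ua i.
  have /andP[v0 _] := vb i; have : 0 < u i by rewrite lt_def ui.
  by lra.
have CU : \tr (U *m U^T) <= \tr (C *m U).
  rewrite -Utr (le_trans (diag_le _ lam _ Upos Usupp ul)) //.
  rewrite CE !mulmxBl !linearB /= -[X *m X^T *m U]mulmxA (mxtrace_mulC X).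
  rewrite -[_ *m U *m X]mulmxA UX mulmx0 mxtrace0.
  rewrite -[Y *m Y^T *m U]mulmxA (mxtrace_mulC Y).
  by have := Upos _ Y; lra.
have CV : \tr (V *m V^T) <= - \tr (C *m V).
  rewrite -Vtr (le_trans (diag_le _ (fun i => - lam i) _ Vpos Vsupp vl)) //.
  have -> : diag_mx (\row_i - lam i) = - diag_mx (\row_i lam i).
    by apply/matrixP => i j; rewrite !mxE mulNrn.
  rewrite CE !mulmxBl mulNmx !linearB /= linearN /=.
  rewrite -[X *m X^T *m V]mulmxA (mxtrace_mulC X).
  rewrite -[Y *m Y^T *m V]mulmxA (mxtrace_mulC Y).
  rewrite -[_ *m V *m Y]mulmxA VY mulmx0 mxtrace0.
  by have := Vpos _ X; lra.
have trC (Z : 'M[R]_n) : \tr (C *m Z^T) = \tr (C *m Z).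
  by rewrite -mxtrace_tr trmx_mul trmxK CT mxtrace_mulC.
have VU : \tr (V *m U^T) = 0 by rewrite -mxtrace_tr trmx_mul trmxK.
(* By orthogonality [|U - V|^2 = |U|^2 + |V|^2], which [CU] and [CV] bound by [<C, U - V>]. *)
have := mxtrace_sqr_ge0 (C - (U - V)).
rewrite opprB [(C + _)^T]linearD /= [(V - U)^T]linearB /= CT.
rewrite !mulmxDl !mulmxDr !mulNmx !mulmxN !linearD /= !linearN /= UV VU !trC.
rewrite (mxtrace_mulC U C) (mxtrace_mulC V C).
by lra.
Qed.

(** * The Lorentz form, orthogonal invariance and least squares *)

Lemma Jmx_diag (R : realType) d :
  Jmx R d = diag_mx (\row_j (if j == ord0 then 1 else -1)).
Proof. by apply/matrixP => i j; rewrite !mxE; case: eqP => [->|]. Qed.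

(** Brings a Lorentz Gram matrix into the shape of [signature_approx_bound] with [p = 1] and
    [q = d]. *)
Lemma mulmx_Jmx_tr (R : realType) n d (X : 'M[R]_(n, d.+1)) :
  X *m Jmx R d *m X^T =
  col ord0 X *m (col ord0 X)^T - col' ord0 X *m (col' ord0 X)^T.
Proof.
rewrite Jmx_diag; apply/matrixP => i k.
rewrite mul_mx_diag !mxE big_ord_recl big_ord1 !mxE /= mulr1; congr (_ + _).
rewrite -sumrN; apply: eq_bigr => j _; rewrite !mxE /=; ring.
Qed.

Lemma mxtrace_sqr_orthogonal_conj (R : comNzRingType) n (Q C : 'M[R]_n) :
  Q^T *m Q = 1%:M ->
  \tr (Q *m C *m Q^T *m (Q *m C *m Q^T)^T) = \tr (C *m C^T).
Proof.
move=> QTQ; rewrite !trmx_mul trmxK !mulmxA -(mulmxA _ Q^T Q) QTQ mulmx1.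
by rewrite mxtrace_mulC !mulmxA QTQ mul1mx.
Qed.

(** Pythagoras: the residual is orthogonal to every [Y *m B], so moving away from [X] adds
    [|Y B|^2]. *)
Lemma least_squares_optimal (R : realFieldType) m n p (A : 'M[R]_(m, n))
    (B : 'M[R]_(p, n)) (X X' : 'M[R]_(m, p)) :
  (A - X *m B) *m B^T = 0 ->
  \tr ((A - X *m B) *m (A - X *m B)^T) <=
  \tr ((A - X' *m B) *m (A - X' *m B)^T).
Proof.
set r := A - X *m B => rB.
have -> : A - X' *m B = r + (X - X') *m B.
  by rewrite mulmxBl addrA subrK.
set Y := X - X'.
have rY : r *m (Y *m B)^T = 0 by rewrite trmx_mul mulmxA rB mul0mx.
have Yr : Y *m B *m r^T = 0 by rewrite -[LHS]trmxK trmx_mul trmxK rY linear0.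
clearbody r Y.
rewrite [(r + _)^T]linearD /= mulmxDl !mulmxDr rY Yr addr0 add0r linearD /=.
by rewrite lerDl mxtrace_sqr_ge0.
Qed.

(** * Signs of the entries and of the eigenvalues *)

Lemma coshR_gt0 (R : realType) (x : R) : 0 < coshR x.
Proof. by rewrite divr_gt0 // addr_gt0 // expR_gt0. Qed.

Lemma coshR0 (R : realType) : coshR (0 : R) = 1.
Proof. by rewrite /coshR oppr0 expR0; field. Qed.

(** The trace is the sum of the eigenvalues, hence nonpositive if the largest one is. *)
Lemma sorted_eigendecomp_lead_gt0 (R : realType) l (A Q : 'M[R]_l)
    (lam : 'I_l -> R) (i0 : 'I_l) :
  sorted_eigendecomp A Q lam -> 0 < \tr A -> val i0 = 0%N -> 0 < lam i0.
Proof.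
move=> [QTQ [-> lam_sorted]] + i00; rewrite mxtrace_mulC mulmxA QTQ mul1mx.
rewrite mxtrace_diag; apply: contraTT; rewrite -!leNgt => lam0.
apply: sumr_le0 => i _; rewrite mxE (le_trans _ lam0) //.
by apply: lam_sorted; rewrite i00.
Qed.

(** If [lam k >= 0], all negative eigenvalues come after [k], which leaves only [l - k - 1 < d]
    places. *)
Lemma sorted_tail_lt0 (R : realDomainType) l d (lam : 'I_l -> R) (k : 'I_l) :
  (forall i j : 'I_l, (i <= j)%N -> lam j <= lam i) ->
  (d <= #|[pred i | (lam i < 0)%R]|)%N -> (l - d <= k)%N -> lam k < 0.
Proof.
move=> lam_sorted d_neg ldk; rewrite ltNge; apply/negP => lamk.
have : (#|[pred i | (lam i < 0)%R]| <= #|[pred i : 'I_l | (k < i)%N]|)%N.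
  apply/subset_leq_card/subsetP => i; rewrite !inE ltnNge; apply: contraTN.
  by move=> /lam_sorted/(le_trans lamk); rewrite -leNgt.
have -> : #|[pred i : 'I_l | (k < i)%N]| = (l - k.+1)%N.
  have /= := cardC [pred i : 'I_l | (k < i)%N]; rewrite card_ord.
  (* The complement is the initial segment up to [k], counted as the image of ['I_k.+1]; [k < l]
     unfolds to [k.+1 <= l]. *)
  have widen_inj : injective (widen_ord (ltn_ord k)).
    by move=> i j /(congr1 val) /= ij; apply: val_inj.
  have -> : #|[predC [pred i : 'I_l | (k < i)%N]]| = k.+1.
    rewrite -[RHS]card_ord -(card_image widen_inj).
    apply: eq_card => i; rewrite !inE -leqNgt; apply/idP/imageP => [ik|[j _ ->]].
      by exists (Ordinal (ik : (i < k.+1)%N)) => //; apply: val_inj.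
    by rewrite /= -ltnS.
  by move=> cardE; rewrite -[RHS](congr1 (subn^~ k.+1) cardE) addnK.
by have := ltn_ord k; lia.
Qed.

(** * Optimality and positivity of the L-hydra output *)

Theorem theorem2 (R : realType) (l m d : nat) (kappa : R)
    (DL : 'M[R]_l) (DN : 'M[R]_(m, l)) (Q : 'M[R]_l) (lam : 'I_l -> R) :
  DL^T = DL ->
  (forall i, DL i i = 0) ->
  (forall i j, 0 <= DL i j) ->
  (forall i j, 0 <= DN i j) ->
  (1 <= d)%N ->
  0 < kappa ->
  (* Step 1: (Q, lam) is an eigendecomposition of A_L = cosh(sqrt kappa D_L)
     with Q orthogonal and eigenvalues sorted nonincreasingly, and the first
     column q_1 of Q (Perron vector) has positive entries *)
  sorted_eigendecomp (cosh_mx kappa DL) Q lam ->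
  (forall i, 0 < colnat Q 0 i) ->
  (* A_L has at least d strictly negative eigenvalues (with multiplicity) *)
  (d <= #|[pred i | (lam i < 0)%R]|)%N ->
  exists (XL : 'M[R]_(l, d.+1)) (XN : 'M[R]_(m, d.+1)),
    lhydra Q lam DN d kappa = Some (XL, XN) /\
    (* (i) *)
    (forall XL' : 'M[R]_(l, d.+1),
       frob (cosh_mx kappa DL - XL *m Jmx R d *m XL^T)
       <= frob (cosh_mx kappa DL - XL' *m Jmx R d *m XL'^T)) /\
    (* (ii) *)
    (forall XN' : 'M[R]_(m, d.+1),
       frob (cosh_mx kappa DN - XN *m Jmx R d *m XL^T)
       <= frob (cosh_mx kappa DN - XN' *m Jmx R d *m XL^T)) /\
    (* (iii) *)
    (forall i, 0 < XL i ord0) /\ (forall i, 0 < XN i ord0).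
Proof.
move=> _ DL0 _ _ d_gt0 _ eigA q_gt0 d_neg.
have l_gt0 : (0 < l)%N.
  rewrite (leq_trans d_gt0) // (leq_trans d_neg) //.
  by rewrite -[leqRHS]card_ord max_card.
pose i0 := Ordinal l_gt0.
have q0_gt0 i : 0 < Q i i0.
  by have := q_gt0 i; rewrite /colnat -[0%N]/(val i0) valK.
(* The zero diagonal of [DL] and [cosh 0 = 1] give [A_L] a positive trace. *)
have lam0 : 0 < lam i0.
  apply: (sorted_eigendecomp_lead_gt0 eigA) => //.
  apply: (@lt_le_trans _ _ 1) => //; rewrite /mxtrace (bigD1 i0) //=.
  rewrite mxE DL0 mulr0 coshR0 lerDl; apply: sumr_ge0 => i _.
  by rewrite mxE ltW ?coshR_gt0.
have [QTQ [AE lam_sorted]] := eigA.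
have QQT := mulmx1C QTQ.
(* Index [i0] carries a positive eigenvalue, so the negative ones cannot fill all [l] places. *)
have d_lt_l : (d < l)%N.
  rewrite (leq_ltn_trans d_neg) // -[ltnRHS]card_ord; apply: proper_card.
  by apply/properP; split; [exact/subsetP|exists i0; rewrite // inE -leNgt ltW].
have tail_lt0 (k : 'I_l) : (l - d <= k)%N -> lam k < 0.
  exact: sorted_tail_lt0.
have e_lt (j : 'I_d.+1) : (eidx l j < l)%N.
  by rewrite /eidx; case: eqP => // _; have := ltn_ord j; lia.
pose e j : 'I_l := Ordinal (e_lt j).
have e_inj : injective e.
  move=> i j /(congr1 val) /=; rewrite /eidx => eij; apply: val_inj.
  move: eij; have := ltn_ord i; have := ltn_ord j.
  by case: eqP; case: eqP => /=; lia.
have e0 : e ord0 = i0 by apply: val_inj.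
have e_tail j : j != ord0 -> (l - d <= e j)%N.
  move=> j0; have j_gt0 : (0 < j)%N by rewrite lt0n; exact: j0.
  by rewrite /= /eidx -[val j]/(j : nat) eqn0Ngt j_gt0 /=; lia.
(* [sg] is the diagonal of J and [s j] is the absolute value of the kept eigenvalue, which treats
   the first column and the others uniformly. *)
pose sg (j : 'I_d.+1) : R := if j == ord0 then 1 else -1.
have sgsg j : sg j * sg j = 1 by rewrite /sg; case: eqP; rewrite ?mulrNN mulr1.
pose s (j : 'I_d.+1) := sg j * lam (e j).
have s_gt0 j : 0 < s j.
  rewrite /s /sg; case: eqVneq => [->|/e_tail/tail_lt0]; first by rewrite mul1r e0.
  by rewrite mulN1r oppr_gt0.
pose r := \row_j Num.sqrt (s j).
pose Qe := colsub e Q.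
have QeQe : Qe^T *m Qe = 1%:M.
  apply/matrixP => i j; have /matrixP/(_ (e i) (e j)) := QTQ.
  rewrite !mxE (inj_eq e_inj) => <-.
  by apply: eq_bigr => k _; rewrite !mxE.
set XL := Qe *m diag_mx r.
set W := Qe *m diag_mx (\row_j (sg j / Num.sqrt (s j))).
exists XL, (cosh_mx kappa DN *m W); split.
  rewrite /lhydra d_lt_l /=.
  have -> : [forall k : 'I_l, (l - d <= k)%N ==> (lam k < 0)].
    by apply/forallP => k; apply/implyP/tail_lt0.
  have colE j i : colnat Q (eidx l j) i = Q i (e j).
    by rewrite /colnat -[eidx l j]/(val (e j)) valK.
  have lamE j : lamnat lam (eidx l j) = lam (e j).
    by rewrite /lamnat -[eidx l j]/(val (e j)) valK.
  have val0 (j : 'I_d.+1) : (val j == 0%N) = (j == ord0) by [].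
  rewrite /=; congr (Some (pair _ _)); last congr (_ *m _);
    apply/matrixP => i j; rewrite ?/XL ?/W mul_mx_diag !mxE colE lamE val0.
    by rewrite mulrC /s /sg; case: eqP => _; rewrite ?mul1r ?mulN1r.
  rewrite /s /sg; case: eqP => _; rewrite ?mulN1r ?mul1r //.
  by rewrite mulNr mulrN.
pose S := [set e j | j : 'I_d.+1].
have sum_S (F : 'I_l -> R) : \sum_(p in S) F p = \sum_j F (e j).
  by rewrite big_imset //= => x y _ _; exact: e_inj.
have sqr_r j : r 0 j * r 0 j = s j by rewrite mxE -expr2 sqr_sqrtr ?ltW.
split; [|split; [|split]].
- move=> XL'; apply: frob_le.
  (* [XL J XL^T] reproduces exactly the eigenpairs indexed by [S], so the residual carries the
     discarded eigenvalues. *)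
  have -> : cosh_mx kappa DL - XL *m Jmx R d *m XL^T =
      Q *m diag_mx (\row_i (if i \in S then 0 else lam i)) *m Q^T.
    have -> : XL *m Jmx R d *m XL^T =
        Q *m diag_mx (\row_i (if i \in S then lam i else 0)) *m Q^T.
      rewrite Jmx_diag /XL trmx_mul tr_diag_mx; apply/matrixP => i k.
      rewrite !mul_mx_diag mul_diag_mx !mxE.
      transitivity (\sum_(p in S) Q i p * lam p * Q k p).
        rewrite sum_S; apply: eq_bigr => j _; rewrite !mxE -/(sg j).
        have := sqr_r j; rewrite mxE => sj.
        transitivity
          (Q i (e j) * (sg j * (Num.sqrt (s j) * Num.sqrt (s j))) * Q k (e j)).
          by ring.
        by rewrite sj /s (mulrA (sg j)) sgsg mul1r.
      rewrite big_mkcond; apply: eq_bigr => p _; rewrite !mxE.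
      by case: ifP => _; rewrite ?mulr0 ?mul0r.
    rewrite AE -mulmxBl -mulmxBr -linearB; congr (_ *m diag_mx _ *m _).
    by apply/rowP => i; rewrite !mxE; case: ifP; rewrite ?subrr ?subr0.
  set Y := Q^T *m XL'.
  have -> : cosh_mx kappa DL - XL' *m Jmx R d *m XL'^T =
      Q *m (diag_mx (\row_i lam i) - Y *m Jmx R d *m Y^T) *m Q^T.
    rewrite mulmxBr mulmxBl -AE /Y trmx_mul trmxK !mulmxA QQT mul1mx.
    by rewrite -(mulmxA _ Q) QQT mulmx1.
  rewrite !mxtrace_sqr_orthogonal_conj // [Y *m _ *m _]mulmx_Jmx_tr.
  (* Column 1 uses the 0-based index [l - d], the largest of the [d] kept negative eigenvalues;
     [- lam (e j1)] is the truncation level b. *)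
  pose j1 : 'I_d.+1 := lift ord0 (Ordinal d_gt0).
  have lam_j1 : lam (e j1) < 0 by apply/tail_lt0/e_tail.
  have e_j1 : val (e j1) = (l - d)%N by rewrite /= /eidx /= /bump; lia.
  have notin_S p : p \notin S -> lam (e j1) <= lam p.
    move=> pS; apply: lam_sorted; rewrite e_j1 leqNgt; apply: contra pS => ldp.
    have jlt : (p - (l - d) < d)%N by have := ltn_ord p; lia.
    apply/imsetP; exists (lift ord0 (Ordinal jlt)) => //; apply: val_inj.
    by rewrite /= /eidx /= /bump; lia.
  (* [u p ^+ 2 + v p ^+ 2] is [lam p ^+ 2] at a discarded index p, and the kept
     indices contribute exactly the loss [a^2 + d b^2] of the bound. *)
  pose u p := Num.max 0 (lam p).
  pose v p := Num.max 0 (Num.min (- lam p) (- lam (e j1))).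
  have lam_le p : lam p <= lam i0 by apply: lam_sorted.
  apply: le_trans (@signature_approx_bound _ _ _ _ lam u v (lam i0)
    (- lam (e j1)) _ _ _ erefl _ _ _ _); first 1 last.
  + by move=> p; rewrite /u le_max lexx /= ge_max lam_le ltW.
  + by move=> p; rewrite /v le_max lexx /= ge_max ge_min lexx orbT oppr_ge0 ltW.
  + by move=> p; rewrite /u; case: (leP 0 (lam p)) => // _; rewrite eqxx.
  + move=> p; rewrite /v; case: (leP 0 (Num.min _ _)) => [_ _|_];
      last by rewrite eqxx.
    by rewrite ge_min lexx.
  have sum_eS : \sum_j (u (e j) ^+ 2 + v (e j) ^+ 2) =
      lam i0 ^+ 2 + d%:R * (- lam (e j1)) ^+ 2.
    rewrite big_ord_recl e0 (eq_bigr (fun=> (- lam (e j1)) ^+ 2)); last first.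
      move=> j _; have ej : lam (e (lift ord0 j)) < 0 by apply/tail_lt0/e_tail.
      have jj1 : lam (e (lift ord0 j)) <= lam (e j1).
        by apply: lam_sorted; rewrite e_j1 e_tail.
      rewrite /u /v max_l ?(ltW ej) // min_r ?lerN2 //.
      by rewrite max_r ?oppr_ge0 ?(ltW lam_j1) // expr0n add0r.
    rewrite sumr_const card_ord /u /v max_r ?ltW // max_l.
      by rewrite expr0n addr0 mulr_natl.
    by rewrite ge_min oppr_le0 ltW.
  rewrite mxtrace_mul_tr -big_split /= [X in _ <= X - _ - _](bigID (mem S)) /=.
  rewrite sum_S sum_eS mul1r.
  rewrite [leRHS](_ : _ = \sum_(p | p \notin S) (u p ^+ 2 + v p ^+ 2));
    last by ring.
  rewrite [leRHS]big_mkcond /=; apply: ler_sum => p _.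
  rewrite (bigD1 p) //= big1 ?addr0 => [|k kp]; last first.
    by rewrite !mxE eq_sym (negPf kp) mulr0n mulr0.
  rewrite !mxE eqxx mulr1n; case: (boolP (p \in S)) => /= [_|/notin_S pj1].
    by rewrite mulr0.
  (* At a discarded index [- lam p] is at most b, so the truncation is inactive. *)
  rewrite /u /v min_l ?lerN2 //.
  case: (leP 0 (lam p)) => lp.
    by rewrite max_l ?oppr_le0 // expr0n addr0 expr2.
  by rewrite max_r ?oppr_ge0 ?(ltW lp) // expr0n add0r sqrrN expr2.
- move=> XN'; apply: frob_le; rewrite -!(mulmxA _ (Jmx R d)).
  (* The signs and roots cancel: [W J XL^T] is [Qe Qe^T], the projection onto the kept eigenvectors,
     which fixes the columns of [XL]. This yields the normal equation for [A_N W]. *)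
  have WXL : W *m (Jmx R d *m XL^T) *m XL = XL.
    rewrite /W /XL trmx_mul tr_diag_mx -!mulmxA (mulmxA Qe^T) QeQe mul1mx.
    rewrite Jmx_diag !mulmx_diag; congr (_ *m diag_mx _).
    apply/rowP => j; have := sqr_r j; rewrite !mxE -/(sg j) => ->.
    transitivity (sg j * sg j * (s j / Num.sqrt (s j))); first by ring.
    rewrite sgsg mul1r -{1}[s j]sqr_sqrtr ?(ltW (s_gt0 j)) // expr2 mulfK //.
    by rewrite gt_eqF // sqrtr_gt0.
  apply: least_squares_optimal; rewrite [(Jmx _ _ *m _)^T]trmx_mul trmxK.
  by rewrite mulmxA mulmxBl -(mulmxA _ W) -(mulmxA _ _ XL) WXL subrr mul0mx.
- move=> i; rewrite /XL mul_mx_diag !mxE mulr_gt0 ?sqrtr_gt0 //.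
  by rewrite e0 q0_gt0.
- have W_gt0 k : 0 < W k ord0.
    by rewrite /W mul_mx_diag !mxE e0 mulr_gt0 ?q0_gt0 // divr_gt0 ?sqrtr_gt0 //.
  have AN_gt0 i k : 0 < cosh_mx kappa DN i k by rewrite mxE coshR_gt0.
  (* The term at [i0] makes the sum strictly positive. *)
  move=> i; rewrite mxE (bigD1 i0) //= ltr_wpDr ?mulr_gt0 //.
  by apply: sumr_ge0 => k _; rewrite mulr_ge0 ?ltW.
Qed.
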